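(* Let $((E^k,\|\cdot\|_k):k\in\mathbb N)$ be a multi-normed space, where $E$ is a complex normed space. For each $k\in\mathbb N$, let $\|\cdot\|_k'$ be the dual norm on $(E')^k$ given by $$\|(\lambda_1,\dots,\lambda_k)\|_k'=\sup\Big\{\Big|\sum_{j=1}^k\langle x_j,\lambda_j\rangle\Big| : x_1,\dots,x_k\in E,\ \|(x_1,\dots,x_k)\|_k\le 1\Big\}\quad(\lambda_1,\dots,\lambda_k\in E').$$ Then $(((E')^k,\|\cdot\|_k'):k\in\mathbb N)$ is a dual multi-Banach space.
   Context: Let $(E,\|\cdot\|)$ be a complex normed space with dual space $E'$, and let $\mathfrak S_k$ be the group of permutations of $\{1,\dots,k\}$. Consider a sequence $(\|\cdot\|_k:k\in\mathbb N)$ such that $\|\cdot\|_k$ is a norm on $E^k$ for each $k$ and $\|x\|_1=\|x\|$ for $x\in E$. Consider the following axioms, imposed for each $k\ge2$: (A1) $\|(x_{\sigma(1)},\dots,x_{\sigma(k)})\|_k=\|(x_1,\dots,x_k)\|_k$ for all $\sigma\in\mathfrak S_k$ and $x_1,\dots,x_k\in E$; (A2) $\|(\alpha_1x_1,\dots,\alpha_kx_k)\|_k\le(\max_i|\alpha_i|)\,\|(x_1,\dots,x_k)\|_k$ for all $\alpha_1,\dots,\alpha_k\in\mathbb C$ and $x_1,\dots,x_k\in E$; (A3) $\|(x_1,\dots,x_{k-1},0)\|_k=\|(x_1,\dots,x_{k-1})\|_{k-1}$ for all $x_1,\dots,x_{k-1}\in E$; (A4) $\|(x_1,\dots,x_{k-2},x_{k-1},x_{k-1})\|_k=\|(x_1,\dots,x_{k-2},x_{k-1})\|_{k-1}$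 for all $x_1,\dots,x_{k-1}\in E$; (B4) $\|(x_1,\dots,x_{k-2},x_{k-1},x_{k-1})\|_k=\|(x_1,\dots,x_{k-2},2x_{k-1})\|_{k-1}$ for all $x_1,\dots,x_{k-1}\in E$. The family $((E^k,\|\cdot\|_k):k\in\mathbb N)$ is a multi-normed space if (A1)–(A4) hold, and a dual multi-normed space if (A1), (A2), (A3), (B4) hold; it is a multi-Banach space, respectively a dual multi-Banach space, if moreover $(E,\|\cdot\|)$ is complete. *)

(* Defs.v *)
From HB Require Import structures.
From mathcomp Require Import all_boot all_order all_algebra all_fingroup.
From mathcomp Require Import all_classical all_reals all_analysis.
From mathcomp Require Import complex.

Set Implicit Arguments.
Unset Strict Implicit.
Unset Printing Implicit Defensive.

Import Order.TTheory GRing.Theory Num.Theory.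
Import numFieldNormedType.Exports.

Local Open Scope classical_set_scope.
Local Open Scope ring_scope.

(* The norm of a [normedModType R[i]] takes its values in [R[i]].  The norms
   on the powers of a space are taken [R]-valued instead, with [absC] the
   [R]-valued modulus, so that suprema can be formed; [x%:C] embeds [R] in
   [R[i]]. *)
Notation absC := ComplexField.Normc.normc.

Lemma absCE (R : rcfType) (z : R[i]) : `|z| = (absC z)%:C%C.
Proof. by []. Qed.

Lemma absC_ge0 (R : rcfType) (z : R[i]) : 0 <= absC z.
Proof. by rewrite -lecR -absCE; exact: normr_ge0. Qed.

Section Dual.
Variables (R : realType) (E : normedModType R[i]).

Definition dual_pred : {pred E -> R[i]^o} :=
  fun f => `[< linear f /\ continuous f >].

Lemma dual_submod_closed : submod_closed dual_pred.
Proof.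
split=> [|a f g /asboolP[fl fc] /asboolP[gl gc]]; apply/asboolP; split.
- by move=> a x y; rewrite scaler0 addr0.
- exact: cst_continuous.
- move=> c x y; rewrite /= !fctE fl gl !scalerDr !scalerA (mulrC a c).
  by rewrite addrACA.
- by move=> x; apply: cvgD; [apply: cvgZr; exact: fc|exact: gc].
Qed.

HB.instance Definition _ :=
  GRing.isSubmodClosed.Build R[i] (E -> R[i]^o) dual_pred dual_submod_closed.

Record dual_space := Dual { dual_fun :> E -> R[i]^o; _ : dual_fun \in dual_pred }.

HB.instance Definition _ := [isSub for dual_fun].
HB.instance Definition _ := [Choice of dual_space by <:].
HB.instance Definition _ := [SubChoice_isSubLmodule of dual_space by <:].

Lemma dual_linear (f : dual_space) : linear f.
Proof. by have /asboolP[] := valP f. Qed.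

HB.instance Definition _ (f : dual_space) :=
  GRing.isLinear.Build R[i] E R[i]^o *:%R (dual_fun f) (@dual_linear f).

Lemma dual_continuous (f : dual_space) : continuous f.
Proof. by have /asboolP[] := valP f. Qed.

Lemma dualD (f g : dual_space) x : (f + g) x = f x + g x.
Proof. by []. Qed.

Lemma dualZ a (f : dual_space) x : (a *: f) x = a * f x.
Proof. by []. Qed.

Definition dual_ball_values (f : dual_space) : set R :=
  [set absC (f x) | x in [set x : E | `|x| <= 1]].

Definition opnorm (f : dual_space) : R := sup (dual_ball_values f).

Lemma dual_ball_values_has_sup (f : dual_space) : has_sup (dual_ball_values f).
Proof.
split; first by exists (absC (f 0)), 0 => //=; rewrite normr0 ler01.
have /linear_boundedP fb := (linear_bounded_continuous f).2 (@dual_continuous f).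
have [r [rr fr]] := fb.
have {}fr := fr (r + 1) ltac:(by rewrite ltrDl).
have r1 : r + 1 \is Num.real by rewrite rpredD// rpred1.
exists (complex.Re `|r + 1|) => _ [x /= x1 <-].
have : `|f x| <= `|r + 1|.
  apply: (le_trans (fr x)); apply: (@le_trans _ _ (`|r + 1| * `|x|)).
    by rewrite ler_wpM2r// real_ler_norm.
  by rewrite ler_piMr.
by rewrite [`|f x|]absCE [`|r + 1|]absCE lecR.
Qed.

Lemma opnorm_ub (f : dual_space) x : `|x| <= 1 -> absC (f x) <= opnorm f.
Proof.
move=> x1; apply: sup_upper_bound; first exact: dual_ball_values_has_sup.
by exists x.
Qed.

Lemma opnorm_le (f : dual_space) (M : R) :
  (forall x, `|x| <= 1 -> absC (f x) <= M) -> opnorm f <= M.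
Proof.
move=> H; apply: ge_sup; first by have [] := dual_ball_values_has_sup f.
by move=> _ [x /= x1 <-]; exact: H.
Qed.

Lemma opnormD (f g : dual_space) :
  (opnorm (f + g))%:C%C <= (opnorm f)%:C%C + (opnorm g)%:C%C.
Proof.
rewrite -rmorphD lecR; apply: opnorm_le => x x1.
by rewrite dualD (le_trans (le_normcD _ _))// lerD// opnorm_ub.
Qed.

Lemma opnormZ_le a (f : dual_space) : opnorm (a *: f) <= absC a * opnorm f.
Proof.
apply: opnorm_le => x x1; rewrite dualZ ComplexField.Normc.normcM.
rewrite ler_wpM2l ?opnorm_ub//.
exact: absC_ge0.
Qed.

Lemma opnormZ a (f : dual_space) : (opnorm (a *: f))%:C%C = `|a| * (opnorm f)%:C%C.
Proof.
rewrite absCE -rmorphM; congr (_%:C%C); apply/eqP; rewrite eq_le opnormZ_le/=.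
have [->|a0] := eqVneq a 0.
  rewrite ComplexField.Normc.normc0 mul0r scale0r.
  apply: le_trans (@opnorm_ub 0 0 _); last by rewrite normr0.
  exact: absC_ge0.
have na0 : 0 < absC a by rewrite -ltcR -absCE normr_gt0.
rewrite -ler_pdivlMl// -ComplexField.Normc.normcV.
by rewrite -{1}[f](scalerK a0) opnormZ_le.
Qed.

Lemma opnorm_eq0 (f : dual_space) : (opnorm f)%:C%C = 0 -> f = 0.
Proof.
move=> [f0]; apply/val_inj/funext => x /=.
have [->|x0] := eqVneq x 0; first by rewrite linear0.
have nx0 : `|x| != 0 by rewrite normr_eq0.
have := @opnorm_ub f (`|x|^-1 *: x).
rewrite normrZ normfV normr_id mulVf// lexx f0 => /(_ isT).
rewrite linearZ/= -lecR -absCE normr_le0 mulf_eq0 invr_eq0 (negbTE nx0)/=.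
by move/eqP.
Qed.

HB.instance Definition _ := Lmodule_isNormed.Build R[i] dual_space
  opnormD opnormZ opnorm_eq0.

End Dual.

(* The value at [k = 0] of a family of norms is irrelevant throughout. *)
Definition power_norms (R : realType) (E : normedModType R[i]) : Type :=
  forall k : nat, {ffun 'I_k -> E} -> R.

Definition snoc (T : Type) (k : nat) (x : {ffun 'I_k -> T}) (y : T) :
    {ffun 'I_k.+1 -> T} :=
  [ffun i => if unlift ord_max i is Some j then x j else y].

Definition is_norm (R : realType) (V : lmodType R[i]) (p : V -> R) : Prop :=
  [/\ forall x, 0 <= p x,
      forall x, p x = 0 -> x = 0,
      forall (a : R[i]) x, p (a *: x) = absC a * p x &
      forall x y, p (x + y) <= p x + p y].

Section MultiNorms.
Variables (R : realType) (E : normedModType R[i]).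
Implicit Type N : power_norms E.

Definition norm_sequence N : Prop :=
  (forall k, (0 < k)%N -> is_norm (N k)) /\
  (forall x : E, (N 1 [ffun=> x])%:C%C = `|x|).

Definition axiomA1 N : Prop :=
  forall (k : nat) (s : 'S_k) (x : {ffun 'I_k -> E}), (2 <= k)%N ->
    N k [ffun i => x (s i)] = N k x.

Definition axiomA2 N : Prop :=
  forall (k : nat) (a : 'I_k -> R[i]) (x : {ffun 'I_k -> E}), (2 <= k)%N ->
    N k [ffun i => a i *: x i] <= (\big[Num.max/0]_(i < k) absC (a i)) * N k x.

(* (A3) is stated for the norm of index [k.+1], (A4) and (B4) for the norm of
   index [k.+2]; thus [k = 0] in the latter two compares the norms of [(y, y)]
   and of [y] or [2 y]. *)
Definition axiomA3 N : Prop :=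
  forall (k : nat) (x : {ffun 'I_k -> E}), (1 <= k)%N ->
    N k.+1 (snoc x 0) = N k x.

Definition axiomA4 N : Prop :=
  forall (k : nat) (x : {ffun 'I_k -> E}) (y : E),
    N k.+2 (snoc (snoc x y) y) = N k.+1 (snoc x y).

Definition axiomB4 N : Prop :=
  forall (k : nat) (x : {ffun 'I_k -> E}) (y : E),
    N k.+2 (snoc (snoc x y) y) = N k.+1 (snoc x (2 *: y)).

Definition multi_normed_space N : Prop :=
  norm_sequence N /\ [/\ axiomA1 N, axiomA2 N, axiomA3 N & axiomA4 N].

Definition dual_multi_normed_space N : Prop :=
  norm_sequence N /\ [/\ axiomA1 N, axiomA2 N, axiomA3 N & axiomB4 N].

Definition complete_space : Prop :=
  forall F : set_system E, ProperFilter F -> cauchy F -> cvg F.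

Definition dual_multi_Banach_space N : Prop :=
  dual_multi_normed_space N /\ complete_space.

(* [sup] is 0 on unbounded sets, so the definiteness required by [is_norm]
   can only hold if these suprema are finite. *)
Definition dual_norms N : power_norms (dual_space E) := fun k l =>
  sup [set absC (\sum_(j < k) l j (x j)) | x in [set x | N k x <= 1]].

End MultiNorms.

(* Main.v *)
(* By (A1)-(A3) each coordinate of [x] has norm at most [N x], so the suprema
   defining the dual norms are finite, and they are norms inducing the operator
   norm for [k = 1]. (A1)-(A3) pass to the dual by transposing the operation in
   the pairing; for (B4), pair [(l, m, m)] with [(x, y, z)] and
   [(l, 2 m)] with [(x, (y + z) / 2)], which has smaller norm by (A1) and (A4).
   The dual is complete because the pointwise limit of a Cauchy filter of
   functionals is at bounded distance from one of them, hence continuous. *)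
Require Import Defs.
From HB Require Import structures.
From mathcomp Require Import all_boot all_order all_algebra all_fingroup.
From mathcomp Require Import all_classical all_reals all_analysis.
From mathcomp Require Import complex.

Import Order.TTheory GRing.Theory Num.Theory.
Import numFieldNormedType.Exports.

Local Open Scope classical_set_scope.
Local Open Scope ring_scope.

Set Implicit Arguments.
Unset Strict Implicit.
Unset Printing Implicit Defensive.

(** * Completeness of the scalars *)

Lemma complex_complete (R : realType) (F : set_system R[i]^o) :
  ProperFilter F -> cauchy F -> cvg F.
Proof.
move=> FF /cauchyP Fc.
have Fex (e : R) : 0 < e -> exists z : R[i]^o, F (ball z e%:C%C).
  by move=> e0; apply: Fc; rewrite ltcR.
(* Real and imaginary parts are 1-Lipschitz, so they send [F] to Cauchy filters on [R]. *)
have Re_ball (z w : R[i]) (e : R) : `|z - w| < e%:C%C ->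
    `|complex.Re z - complex.Re w| < e.
  move=> zw; rewrite -ltcR; apply: le_lt_trans zw.
  by case: z w => [a b] [c d]; exact: (normc_ge_Re (Complex (a - c) (b - d))).
have Im_ball (z w : R[i]) (e : R) : `|z - w| < e%:C%C ->
    `|complex.Im z - complex.Im w| < e.
  move=> zw; rewrite -ltcR; apply: le_lt_trans zw.
  case: z w => [a b] [c d].
  by rewrite normc_def lecR/= -sqrtr_sqr ler_wsqrtr// lerDr sqr_ge0.
have FRe : cvg ((fun z : R[i] => complex.Re z) @ F).
  apply/cauchy_cvgP/cauchy_exP => e /Fex[z Fz]; exists (complex.Re z).
  apply: (@filterS _ F _ (ball z e%:C%C)) Fz => w.
  by rewrite -!ball_normE; exact: Re_ball.
have FIm : cvg ((fun z : R[i] => complex.Im z) @ F).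
  apply/cauchy_cvgP/cauchy_exP => e /Fex[z Fz]; exists (complex.Im z).
  apply: (@filterS _ F _ (ball z e%:C%C)) Fz => w.
  by rewrite -!ball_normE; exact: Im_ball.
apply/cvg_ex.
exists (Complex (lim ((fun z : R[i] => complex.Re z) @ F))
                (lim ((fun z : R[i] => complex.Im z) @ F)) : R[i]^o).
apply/fcvgrPdist_lt => e e0.
(* A positive element of [R[i]] is real, so the radius can be halved in [R]. *)
have [r r0 ->] : exists2 r : R, 0 < r & e = r%:C%C.
  exists (complex.Re e); last by rewrite RRe_real// gtr0_real.
  by rewrite -ltcR RRe_real// gtr0_real.
have r20 : 0 < r / 2 by rewrite divr_gt0.
move/cvgrPdist_lt : FRe => /(_ _ r20) FRe.
move/cvgrPdist_lt : FIm => /(_ _ r20) FIm.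
apply: filterS2 FRe FIm => -[a b] /=.
set c := lim _; set d := lim _ => ca db.
have -> : (Complex c d - Complex a b : R[i]) = (c - a)%:C%C + 'i%C * (d - b)%:C%C.
  by simpc.
apply: (le_lt_trans (ler_normD _ _)).
rewrite normrM !normc_def/= !expr0n expr1n add0r !addr0 sqrtr1 mul1r.
rewrite !sqrtr_sqr -rmorphD ltcR.
by rewrite [r in ltRHS]splitr ltrD.
Qed.

(** * Completeness of the dual space *)

Section Dual.
Variables (R : realType) (E : normedModType R[i]).

Lemma dual_norm_ub (f : dual_space E) x : `|f x| <= `|f| * `|x|.
Proof.
have [->|x0] := eqVneq x 0; first by rewrite linear0 !normr0 mulr0.
have nx0 : 0 < `|x| by rewrite normr_gt0.
have := @opnorm_ub _ _ f (`|x|^-1 *: x).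
rewrite normrZ normfV normr_id mulVf ?gt_eqF// => /(_ (lexx _)).
rewrite linearZ -lecR -absCE normrM normfV normr_id.
by rewrite ler_pdivrMl// mulrC.
Qed.

Lemma dual_norm_le (f : dual_space E) (e : R[i]) :
  0 <= e -> (forall x, `|f x| <= e * `|x|) -> `|f| <= e.
Proof.
move=> e0 fe; rewrite -[e]RRe_real ?ger0_real// lecR.
apply: opnorm_le => x x1; rewrite -lecR -absCE RRe_real ?ger0_real//.
by rewrite (le_trans (fe x))// ler_piMr.
Qed.

Lemma dual_complete : complete_space (dual_space E).
Proof.
move=> F FF /cauchyP Fc.
have Feval x : cvg ((fun f : dual_space E => f x) @ F).
  apply: complex_complete; apply/cauchy_exP => e e0.
  (* Dividing by [|x| + 1] instead of [|x|] covers [x = 0] as well. *)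
  have x0 : 0 < `|x| + 1 by rewrite ltr_wpDl.
  have [f0 Ff0] := Fc _ (divr_gt0 e0 x0).
  exists (f0 x); apply: (@filterS _ F _ (ball f0 _)) Ff0 => f.
  rewrite -!ball_normE/= => ff0; have -> : f0 x - f x = (f0 - f) x by [].
  apply: (le_lt_trans (dual_norm_ub _ _)).
  apply: (@le_lt_trans _ _ (`|f0 - f| * (`|x| + 1))).
    by rewrite ler_wpM2l// lerDl.
  by rewrite -ltr_pdivlMr.
pose g x : R[i]^o := lim ((fun f : dual_space E => f x) @ F).
have g_lim x : (fun f : dual_space E => f x) @ F --> g x by exact: Feval.
(* Limit of [|f0 x - f x| <= e * |x|] along [F]: for each slack [d], some [f] is within [e] of [f0]
   and has [f x] within [d] of [g x]. *)
have g_near (f0 : dual_space E) e x : F (ball f0 e) -> `|f0 x - g x| <= e * `|x|.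
  move=> Ff0; apply/ler_addgt0Pr => d d0.
  move/cvgrPdist_lt : (g_lim x) => /(_ _ d0) gd.
  have [f [f0f gf]] := filter_ex (filterI Ff0 gd).
  move: f0f; rewrite -ball_normE/= => f0f.
  rewrite -[f0 x](subrK (f x)) -addrA; apply: (le_trans (ler_normD _ _)).
  apply: lerD; last by rewrite distrC ltW.
  have -> : f0 x - f x = (f0 - f) x by [].
  by rewrite (le_trans (dual_norm_ub _ _))// ler_wpM2r// ltW.
have g_linear : linear g.
  move=> a x y; apply: (norm_cvg_unique (g_lim _)).
  have -> : (fun f : dual_space E => f (a *: x + y)) =
            (fun f : dual_space E => a *: (f x : R[i]^o) + f y).
    by apply/funext => f; rewrite linearP.
  by apply: cvgD => //; apply: cvgZr.
have [f1 Ff1] := Fc 1 ltr01.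
have g_pred : g \in @dual_pred R E.
  apply/asboolP; split => //.
  (* By [g_near] with radius 1, [h] is linear with bound 1, hence continuous, and so is
     [g = f1 - h]. *)
  pose h x : R[i]^o := f1 x - g x.
  have h_linear : linear h.
    move=> a x y; rewrite /h linearP g_linear scalerBr opprD !addrA.
    by congr (_ - _); rewrite addrAC.
  pose hL := HB.pack_for {linear E -> R[i]^o} h
    (GRing.isLinear.Build _ _ _ _ h h_linear).
  have hc : continuous h.
    apply: (@bounded_linear_continuous _ _ _ hL).
    apply/linear_boundedP; exists 1; split; first exact: real1.
    move=> r r1 x; apply: le_trans (g_near f1 1 x Ff1) _.
    by rewrite ler_wpM2r// ltW.
  have -> : g = (fun x => f1 x - h x).
    by apply/funext => x; rewrite /h opprB addrC subrK.
  by move=> x; apply: cvgB; [exact: dual_continuous|exact: hc].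
apply/cvg_ex; exists (Dual g_pred).
apply/fcvgrPdist_lt => e e0; have e20 : 0 < e / 2 by rewrite divr_gt0.
(* The centre [f0] is within [e / 2] of the limit by [g_near], and of [F]-almost every [f]. *)
have [f0 Ff0] := Fc _ e20.
apply: filterS (Ff0) => f; rewrite -ball_normE/= => f0f.
rewrite -[Dual g_pred](subrK f0) -addrA (le_lt_trans (ler_normD _ _))//.
rewrite [e]splitr ler_ltD//; rewrite distrC.
apply: dual_norm_le; first exact: ltW.
by move=> x; apply: g_near.
Qed.

End Dual.

(** * Tuples with a last entry appended *)

Section Snoc.
Variables (T : Type) (k : nat).
Implicit Types (x : {ffun 'I_k -> T}) (y : T).

Lemma snoc_max x y : snoc x y ord_max = y.
Proof. by rewrite ffunE unlift_none. Qed.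

Lemma snoc_lift x y i : snoc x y (lift ord_max i) = x i.
Proof. by rewrite ffunE liftK. Qed.

Lemma eq_snoc (z w : {ffun 'I_k.+1 -> T}) :
  (forall i, z (lift ord_max i) = w (lift ord_max i)) ->
  z ord_max = w ord_max -> z = w.
Proof.
by move=> zw zwm; apply/ffunP => i; case: (unliftP ord_max i) => [j|] ->.
Qed.

Lemma snoc_surj (z : {ffun 'I_k.+1 -> T}) : exists x y, z = snoc x y.
Proof.
exists [ffun i => z (lift ord_max i)], (z ord_max).
by apply: eq_snoc => [i|]; rewrite ?snoc_lift ?snoc_max ?ffunE.
Qed.

End Snoc.

(** Variant of [big_ord_recr] with the initial indices embedded by [lift ord_max], the form in which
    [snoc] reads its entries. *)
Lemma big_ord_recr_lift (R : Type) (idx : R) (op : Monoid.law idx) n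
    (F : 'I_n.+1 -> R) :
  \big[op/idx]_(i < n.+1) F i =
  op (\big[op/idx]_(i < n) F (lift ord_max i)) (F ord_max).
Proof.
rewrite big_ord_recr; congr (op _ _); apply: eq_bigr => i _; congr F.
by apply/val_inj; rewrite /= /bump leqNgt ltn_ord.
Qed.

(** * Consequences of the multi-norm axioms *)

Section PowerNorms.
Variables (R : realType) (E : normedModType R[i]) (N : power_norms E).
Hypothesis hN : multi_normed_space N.

(** Indices have the form [k.+1] from here on, since nothing is assumed of [N] at index 0. *)
Let N_ge0 k (x : {ffun 'I_k.+1 -> E}) : 0 <= N x.
Proof. by have [[+ _] _] := hN => /(_ k.+1 isT)[]. Qed.

Let N_eq0 k (x : {ffun 'I_k.+1 -> E}) : N x = 0 -> x = 0.
Proof. by have [[+ _] _] := hN => /(_ k.+1 isT)[_ + _ _]; apply. Qed.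

Let NZ k a (x : {ffun 'I_k.+1 -> E}) : N (a *: x) = absC a * N x.
Proof. by have [[+ _] _] := hN => /(_ k.+1 isT)[]. Qed.

Let ND k (x y : {ffun 'I_k.+1 -> E}) : N (x + y) <= N x + N y.
Proof. by have [[+ _] _] := hN => /(_ k.+1 isT)[]. Qed.

Let N1 (x : E) : (N (k := 1) [ffun=> x])%:C%C = `|x|.
Proof. by have [[_ +] _] := hN; apply. Qed.

Let N0 k : N (0 : {ffun 'I_k.+1 -> E}) = 0.
Proof. by rewrite -(scale0r 0) NZ ComplexField.Normc.normc0 mul0r. Qed.

(** This is (A2) with any bound [M] on the moduli, extended to index 1 by homogeneity. *)
Lemma norms_contract k (a : 'I_k.+1 -> R[i]) (x : {ffun 'I_k.+1 -> E}) M :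
  (forall i, absC (a i) <= M) -> N [ffun i => a i *: x i] <= M * N x.
Proof.
move=> aM; case: k => [|k] in a x aM *.
  rewrite (_ : [ffun _ => _] = a ord0 *: x).
    by rewrite NZ ler_wpM2r.
  by apply/ffunP => i; rewrite !ffunE (ord1 i).
have [_ [_ A2 _ _]] := hN.
apply: (le_trans (A2 _ _ _ _)) => //; apply: ler_wpM2r => //.
(* The maximum in (A2) starts from 0, so [0 <= M] is required; it follows from the bound on
   [a ord0]. *)
by apply: bigmax_le => //; exact: le_trans (absC_ge0 _) (aM ord0).
Qed.

Lemma norms_perm k (s : 'S_k.+1) (x : {ffun 'I_k.+1 -> E}) :
  N [ffun i => x (s i)] = N x.
Proof.
case: k => [|k] in s x *; last by have [_ [A1 _ _ _]] := hN; exact: A1.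
by congr (N _); apply/ffunP => i; rewrite ffunE (ord1 (s i)) (ord1 i).
Qed.

Definition single k (i : 'I_k) (y : E) : {ffun 'I_k -> E} :=
  [ffun j => if j == i then y else 0].

(** Induction on [k]: a transposition moves [y] to the first coordinate by (A1), and (A3) removes
    the last one, which is then 0. *)
Lemma norms_single k (i : 'I_k.+1) y : (N (single i y))%:C%C = `|y|.
Proof.
elim: k i => [|k IHk] i.
  rewrite -N1; congr (_%:C%C); congr (N _).
  by apply/ffunP => j; rewrite !ffunE !ord1.
have -> : single i y =
    [ffun j => single (lift ord_max ord0) y (tperm (lift ord_max ord0) i j)].
  apply/ffunP => j; rewrite !ffunE.
  by rewrite -(inj_eq (@perm_inj _ (tperm (lift ord_max ord0) i)) j) tpermR.
rewrite norms_perm -(IHk ord0); congr (_%:C%C).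
have [_ [_ _ A3 _]] := hN; rewrite -[RHS]A3//; congr (N _).
apply: eq_snoc => [j|]; first by rewrite snoc_lift !ffunE (inj_eq lift_inj).
by rewrite snoc_max !ffunE (negbTE (neq_lift _ _)).
Qed.

(** Replacing all other coordinates by 0 is a contraction and leaves [single i (x i)]. *)
Lemma coord_le_norms k (x : {ffun 'I_k.+1 -> E}) i : `|x i| <= (N x)%:C%C.
Proof.
rewrite -(norms_single i) lecR -[leRHS]mul1r.
rewrite (_ : single i (x i) = [ffun j => (j == i)%:R *: x j]).
  apply: norms_contract => j; rewrite -lecR -absCE.
  by case: (j == i); rewrite ?normr1 ?normr0.
apply/ffunP => j; rewrite !ffunE.
by case: eqP => [->|]; rewrite ?scale1r ?scale0r.
Qed.

(** Multiplying the last coordinate by 0 is a contraction, and (A3) then drops it. *)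
Lemma norms_le_snoc k (x : {ffun 'I_k.+1 -> E}) y : N x <= N (snoc x y).
Proof.
have [_ [_ _ A3 _]] := hN; rewrite -A3// -[leRHS]mul1r.
rewrite (_ : snoc x 0 = [ffun j => (j != ord_max)%:R *: snoc x y j]).
  apply: norms_contract => j; rewrite -lecR -absCE.
  by case: (j != _); rewrite ?normr1 ?normr0.
apply: eq_snoc => [j|]; rewrite [RHS]ffunE ?snoc_lift ?snoc_max.
  by rewrite eq_sym neq_lift scale1r.
by rewrite eqxx scale0r.
Qed.

Lemma norms_swap k (x : {ffun 'I_k -> E}) y z :
  N (snoc (snoc x y) z) = N (snoc (snoc x z) y).
Proof.
(* [lift ord_max ord_max] is the last index but one. *)
rewrite -(norms_perm (tperm ord_max (lift ord_max ord_max))); congr (N _).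
apply: eq_snoc => [j|]; rewrite ffunE; last by rewrite tpermL snoc_lift !snoc_max.
rewrite snoc_lift; have [->|jm] := eqVneq j ord_max.
  by rewrite tpermR !snoc_max.
rewrite tpermD ?neq_lift ?(inj_eq lift_inj) 1?eq_sym// snoc_lift.
by case: (unliftP ord_max j) jm => [i|] ->; rewrite ?eqxx ?snoc_lift.
Qed.

(* By (A4) the left-hand side is the norm of the average of [(x, y, z)] and
   [(x, z, y)]. *)
Lemma norms_average k (x : {ffun 'I_k -> E}) y z :
  N (snoc x (2^-1 *: (y + z))) <= N (snoc (snoc x y) z).
Proof.
have [_ [_ _ _ A4]] := hN; rewrite -A4.
rewrite (_ : snoc _ _ = 2^-1 *: (snoc (snoc x y) z + snoc (snoc x z) y)).
  have abs2 : absC (2 : R[i]) = 2.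
    by apply: complexI; rewrite -absCE normr_nat rmorph_nat.
  rewrite NZ ComplexField.Normc.normcV abs2 ler_pdivrMl// mulr_natl mulr2n.
  by rewrite (le_trans (ND _ _))// lerD2l norms_swap.
have addE (u v : {ffun 'I_k.+2 -> E}) i :
    (2^-1 *: (u + v)) i = 2^-1 *: (u i + v i) by rewrite !ffunE.
apply: eq_snoc => [j|]; rewrite addE ?snoc_lift ?snoc_max.
  case: (unliftP ord_max j) => [i|] ->; rewrite ?snoc_lift ?snoc_max//.
  by rewrite -mulr2n -[x i *+ 2]scaler_nat scalerA mulVf ?pnatr_eq0// scale1r.
by rewrite addrC.
Qed.

(** * The duality pairing and the dual norms *)

(** The sum inside [dual_norms] is convertible to this, so bounds on [pairing] apply there
    directly. *)
Definition pairing k (l : {ffun 'I_k -> dual_space E}) (x : {ffun 'I_k -> E}) :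
    R[i] :=
  \sum_(j < k) l j (x j).

Lemma pairing_snoc k (l : {ffun 'I_k -> dual_space E}) f x y :
  pairing (snoc l f) (snoc x y) = pairing l x + f y.
Proof.
rewrite /pairing big_ord_recr_lift !snoc_max; congr (_ + _).
by apply: eq_bigr => i _; rewrite !snoc_lift.
Qed.

Lemma pairing_single k (l : {ffun 'I_k -> dual_space E}) i y :
  pairing l (single i y) = l i y.
Proof.
rewrite /pairing (bigD1 i)//= big1 ?addr0 ?ffunE ?eqxx// => j ji.
by rewrite ffunE (negbTE ji) linear0.
Qed.

Lemma pairingZr k (l : {ffun 'I_k -> dual_space E}) a x :
  pairing l (a *: x) = a * pairing l x.
Proof.
by rewrite /pairing mulr_sumr; apply: eq_bigr => i _; rewrite ffunE linearZ.
Qed.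

Lemma pairing0r k (l : {ffun 'I_k -> dual_space E}) : pairing l 0 = 0.
Proof. by rewrite -(scale0r 0) pairingZr mul0r. Qed.

(** A crude bound, from [coord_le_norms] in each term; it serves to make the suprema finite. *)
Lemma pairing_bound k (l : {ffun 'I_k.+1 -> dual_space E}) x :
  absC (pairing l x) <= (\sum_j opnorm (l j)) * N x.
Proof.
rewrite -lecR -absCE rmorphM rmorph_sum mulr_suml.
apply: (le_trans (ler_norm_sum _ _ _)); apply: ler_sum => j _.
apply: (le_trans (dual_norm_ub _ _)); apply: ler_wpM2l; first exact: normr_ge0.
exact: coord_le_norms.
Qed.

Lemma dual_norms_has_sup k (l : {ffun 'I_k.+1 -> dual_space E}) :
  has_sup [set absC (pairing l x) | x in [set x | N x <= 1]].
Proof.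
split; first by exists (absC (pairing l 0)), 0 => //=; rewrite N0.
exists (\sum_j opnorm (l j)) => _ [y /= y1 <-].
apply: le_trans (pairing_bound _ _) _; rewrite ler_piMr// sumr_ge0// => j _.
by rewrite -lecR; exact: (normr_ge0 (l j)).
Qed.

(** For nonzero [x], the definition of the supremum is applied to [x] divided by [N x]. *)
Lemma dual_norms_ub k (l : {ffun 'I_k.+1 -> dual_space E}) x :
  absC (pairing l x) <= dual_norms N l * N x.
Proof.
have [->|x0] := eqVneq x 0.
  by rewrite pairing0r N0 mulr0 ComplexField.Normc.normc0.
have Nx0 : 0 < N x.
  by rewrite lt_def N_ge0 andbT; apply: contra_neq x0; exact: N_eq0.
have absCV : absC (N x)^-1%:C%C = (N x)^-1.
  by apply: complexI; rewrite -absCE ger0_norm// lecR invr_ge0.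
have : absC (pairing l ((N x)^-1%:C%C *: x)) <= dual_norms N l.
  apply: sup_upper_bound; first exact: dual_norms_has_sup.
  by exists ((N x)^-1%:C%C *: x) => //=; rewrite NZ absCV mulVf// gt_eqF.
by rewrite pairingZr ComplexField.Normc.normcM absCV ler_pdivrMl// mulrC.
Qed.

(** Together with [dual_norms_ub], this makes [dual_norms N l] the least nonnegative constant
    bounding the pairing with [l]. *)
Lemma dual_norms_le k (l : {ffun 'I_k.+1 -> dual_space E}) M : 0 <= M ->
  (forall x, absC (pairing l x) <= M * N x) -> dual_norms N l <= M.
Proof.
move=> M0 lM; apply: ge_sup.
  by exists (absC (pairing l 0)), 0 => //=; rewrite N0.
by move=> _ [x /= x1 <-]; rewrite (le_trans (lM x))// ler_piMr.
Qed.

Lemma dual_norms_ge0 k (l : {ffun 'I_k.+1 -> dual_space E}) : 0 <= dual_norms N l.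
Proof.
apply: le_trans (absC_ge0 (pairing l 0)) _.
apply: sup_upper_bound; first exact: dual_norms_has_sup.
by exists 0 => //=; rewrite N0.
Qed.

Lemma dual_norms_is_norm k : is_norm (dual_norms N (k := k.+1)).
Proof.
split => [l|l l0|a l|l m].
- exact: dual_norms_ge0.
- apply/ffunP => i; apply/val_inj/funext => y /=.
  (* Testing [l] on [single i y] isolates its [i]-th functional. *)
  have := dual_norms_ub l (single i y); rewrite l0 mul0r pairing_single.
  by rewrite -lecR -absCE normr_le0 ffunE => /eqP.
(* One inequality suffices: for [a != 0], its instance at the inverse of [a] gives the reverse
   one. *)
- have Zle b (m : {ffun 'I_k.+1 -> dual_space E}) :
      dual_norms N (b *: m) <= absC b * dual_norms N m.
    apply: dual_norms_le => [|x].
      by rewrite mulr_ge0 ?absC_ge0 ?dual_norms_ge0.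
    rewrite (_ : pairing _ _ = b * pairing m x).
      by rewrite ComplexField.Normc.normcM -mulrA ler_wpM2l ?absC_ge0 ?dual_norms_ub.
    by rewrite /pairing mulr_sumr; apply: eq_bigr => j _; rewrite ffunE dualZ.
  apply/eqP; rewrite eq_le Zle/=; have [->|a0] := eqVneq a 0.
    by rewrite ComplexField.Normc.normc0 mul0r dual_norms_ge0.
  rewrite -ler_pdivlMl; last by rewrite -ltcR -absCE normr_gt0.
  by rewrite -ComplexField.Normc.normcV -{1}[l](scalerK a0) Zle.
- apply: dual_norms_le => [|x]; first by rewrite addr_ge0 ?dual_norms_ge0.
  rewrite (_ : pairing _ _ = pairing l x + pairing m x).
    by rewrite mulrDl (le_trans (le_normcD _ _))// lerD ?dual_norms_ub.
  by rewrite /pairing -big_split; apply: eq_bigr => j _; rewrite ffunE dualD.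
Qed.

Lemma dual_norms1 (f : dual_space E) :
  (dual_norms N (k := 1) [ffun=> f])%:C%C = `|f|.
Proof.
have pairing1 (x : {ffun 'I_1 -> E}) : pairing [ffun=> f] x = f (x ord0).
  by rewrite /pairing big_ord1 ffunE.
apply/eqP; rewrite eq_le; apply/andP; split.
  rewrite lecR; apply: dual_norms_le => [|x].
    by rewrite -lecR; exact: (normr_ge0 f).
  rewrite pairing1 -lecR -absCE rmorphM (le_trans (dual_norm_ub _ _))//.
  by apply: ler_wpM2l; [exact: (normr_ge0 f)|exact: coord_le_norms].
apply: dual_norm_le => [|x]; first by rewrite lecR dual_norms_ge0.
rewrite -N1 -rmorphM absCE lecR.
have := dual_norms_ub (k := 0) [ffun=> f] [ffun=> x].
by rewrite pairing1 ffunE.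
Qed.

(** * The dual multi-norm axioms *)

Lemma dual_norms_A1 : axiomA1 (dual_norms N).
Proof.
have le k (s : 'S_k.+1) (l : {ffun 'I_k.+1 -> dual_space E}) :
    dual_norms N [ffun i => l (s i)] <= dual_norms N l.
  apply: dual_norms_le => [|x]; first exact: dual_norms_ge0.
  rewrite -(norms_perm s^-1 x)%g.
  rewrite (_ : pairing _ _ = pairing l [ffun i => x (s^-1%g i)]).
    exact: dual_norms_ub.
  (* Reindexing the sum transfers the permutation from [l] to [x] as its inverse. *)
  rewrite /pairing [RHS](reindex_inj (@perm_inj _ s)).
  by apply: eq_bigr => i _; rewrite !ffunE permK.
move=> [//|k] s l _; apply/eqP; rewrite eq_le le/=.
have := le _ s^-1%g [ffun i => l (s i)].
rewrite (_ : [ffun i => _] = l)//.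
by apply/ffunP => i; rewrite !ffunE permKV.
Qed.

Lemma dual_norms_A2 : axiomA2 (dual_norms N).
Proof.
move=> [//|k] a l _; apply: dual_norms_le => [|x].
  by rewrite mulr_ge0 ?dual_norms_ge0// bigmax_ge_id.
(* By linearity the scalars pass from the functionals to the vectors, where [norms_contract]
   applies. *)
rewrite (_ : pairing _ _ = pairing l [ffun i => a i *: x i]); last first.
  by apply: eq_bigr => i _; rewrite !ffunE linearZ.
rewrite (le_trans (dual_norms_ub _ _))// mulrAC [leRHS]mulrC ler_wpM2l ?dual_norms_ge0//.
by apply: norms_contract => i; exact: le_bigmax.
Qed.

(** The last coordinate of a test vector pairs with 0, so it may be dropped, lowering the norm, or
    appended as 0, preserving it. *)
Lemma dual_norms_A3 : axiomA3 (dual_norms N).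
Proof.
move=> [//|k] l _; apply/eqP; rewrite eq_le; apply/andP; split.
  apply: dual_norms_le => [|z]; first exact: dual_norms_ge0.
  have [x [y ->]] := snoc_surj z; rewrite pairing_snoc addr0.
  rewrite (le_trans (dual_norms_ub _ _))// ler_wpM2l ?dual_norms_ge0//.
  exact: norms_le_snoc.
apply: dual_norms_le => [|x]; first exact: dual_norms_ge0.
have [_ [_ _ A3 _]] := hN; rewrite -A3//.
by have := dual_norms_ub (snoc l 0) (snoc x 0); rewrite pairing_snoc addr0.
Qed.

Lemma dual_norms_B4 : axiomB4 (dual_norms N).
Proof.
move=> k l f; apply/eqP; rewrite eq_le; apply/andP; split.
  apply: dual_norms_le => [|w]; first exact: dual_norms_ge0.
  have [xy [z ->]] := snoc_surj w; have [x [y ->]] := snoc_surj xy.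
  (* The factors 2 and 1/2 cancel, leaving [f y + f z]. *)
  rewrite (_ : pairing _ _ =
      pairing (snoc l (2 *: f)) (snoc x (2^-1 *: (y + z)))).
    rewrite (le_trans (dual_norms_ub _ _))// ler_wpM2l ?dual_norms_ge0//.
    exact: norms_average.
  rewrite !pairing_snoc dualZ linearZ linearD/= mulrA mulfV ?pnatr_eq0//.
  by rewrite mul1r addrA.
apply: dual_norms_le => [|w]; first exact: dual_norms_ge0.
(* Conversely, [(x, y)] is tested as [(x, y, y)]: the norm is unchanged by (A4), and [f y + f y] is
   the value of [2 *: f] at [y]. *)
have [x [y ->]] := snoc_surj w; have [_ [_ _ _ A4]] := hN; rewrite -A4.
have := dual_norms_ub (snoc (snoc l f) f) (snoc (snoc x y) y).
by rewrite !pairing_snoc dualZ mulr_natl mulr2n addrA.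
Qed.

End PowerNorms.

Theorem theorem2p31 (R : realType) (E : normedModType R[i])
    (N : power_norms E) (hN : multi_normed_space N) :
  dual_multi_Banach_space (dual_norms N).
Proof.
split; last exact: dual_complete.
split; first split => [[//|k] _|f].
- exact: dual_norms_is_norm.
- exact: dual_norms1.
split; [exact: dual_norms_A1|exact: dual_norms_A2|exact: dual_norms_A3|].
exact: dual_norms_B4.
Qed.
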